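(* Let $A \in M_{m,n}(\mathbb{R})$ and let $K_1, K_2$ be proper cones in $\mathbb{R}^n$ and $\mathbb{R}^m$, respectively. If $A+B \in S(K_1,K_2)$ for every $B \in S(K_1,K_2)$, then $A \in \pi(K_1,K_2)$.
   Context: $M_{m,n}(\mathbb{R})$ is the space of real $m \times n$ matrices. A set $K \subseteq \mathbb{R}^n$ is a convex cone if $K+K \subseteq K$ and $\alpha K \subseteq K$ for all $\alpha \geq 0$; a convex cone is proper if it is topologically closed, pointed ($K \cap (-K) = \{0\}$) and has nonempty interior, denoted $K^\circ$. For proper cones $K_1 \subseteq \mathbb{R}^n$ and $K_2 \subseteq \mathbb{R}^m$, $\pi(K_1,K_2)$ is the set of $A \in M_{m,n}(\mathbb{R})$ that are nonnegative, i.e. $A(K_1) \subseteq K_2$, and $S(K_1,K_2)$ is the set of $A \in M_{m,n}(\mathbb{R})$ that are semipositive, i.e. there exists $x \in K_1^\circ$ such that $Ax \in K_2^\circ$. *)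

(* Defs.v *)
From HB Require Import structures.
From mathcomp Require Import all_boot all_order all_algebra.
From mathcomp Require Import all_classical all_reals all_analysis.
Import Order.TTheory GRing.Theory Num.Theory.
Import numFieldNormedType.Exports.
Set Implicit Arguments.
Unset Strict Implicit.
Unset Printing Implicit Defensive.
Local Open Scope classical_set_scope.
Local Open Scope ring_scope.

(* Vectors of R^n are column vectors, with the topology of 'M[R]_(n, 1). *)

Definition convex_cone (R : realType) (n : nat) (K : set 'cV[R]_n) : Prop :=
  [set x + y | x in K & y in K] `<=` K /\
  (forall a : R, 0 <= a -> [set a *: x | x in K] `<=` K).

Definition pointed_cone (R : realType) (n : nat) (K : set 'cV[R]_n) : Prop :=
  K `&` [set - x | x in K] = [set 0].

Definition proper_cone (R : realType) (n : nat) (K : set 'cV[R]_n) : Prop :=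
  [/\ convex_cone K, closed K, pointed_cone K & interior K !=set0].

Definition nonneg_mx (R : realType) (m n : nat)
    (K1 : set 'cV[R]_n) (K2 : set 'cV[R]_m) : set 'M[R]_(m, n) :=
  [set A | [set A *m x | x in K1] `<=` K2].

Definition semipos_mx (R : realType) (m n : nat)
    (K1 : set 'cV[R]_n) (K2 : set 'cV[R]_m) : set 'M[R]_(m, n) :=
  [set A | exists2 x, interior K1 x & interior K2 (A *m x)].

(* Main.v *)
Require Import Defs.
From HB Require Import structures.
From mathcomp Require Import all_boot all_order all_algebra.
From mathcomp Require Import all_classical all_reals all_analysis.
From mathcomp Require Import ring lra.
Import Order.TTheory GRing.Theory Num.Theory.
Import numFieldNormedType.Exports.
Local Open Scope classical_set_scope.
Local Open Scope ring_scope.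

(** The proof is by contraposition, with a rank-one perturbation as witness.
    Suppose that [A x] lies outside [K2] for some [x] in [K1].  Since [K2] is a
    closed convex cone, a hyperplane separates them
    ([convex_cone_separation]): some row vector [y] satisfies [y A x < 0] and
    is nonnegative on [K2].  Two facts then turn these weak statements into
    statements about interiors.
    - As [y] takes a negative value somewhere, it is positive on the interior
      of [K2] ([interior_functional_gt0]); fix [b] there, so [y b > 0].
    - The strict inequality [y A x < 0] survives a small displacement of [x]
      towards an interior point of [K1], which lands at some [x0] in the
      interior of [K1] ([interior_cone_functional_lt0]).

    The matrix [B = - b (y A) / (y b)] maps [x0] to a positive multiple of [b],
    hence is semipositive.  On the other hand [y B = - y A], so [y (A + B) = 0]:
    the image of [A + B] lies in the kernel of [y], which misses the interior
    of [K2].  Thus [A + B] is not semipositive.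

    Separation rests on Euclidean projection: with [p] the point of the cone
    closest to a point [v] outside it, [y] is the transpose of [p - v].  The
    Euclidean norm matters because its first-order optimality condition is
    linear; the sup norm that metrizes matrices has no such property. *)

Set Implicit Arguments.
Unset Strict Implicit.

Definition sqnorm (R : realType) (n : nat) (x : 'cV[R]_n) : R :=
  \sum_i x i 0 ^+ 2.

Lemma sqnorm_ge0 (R : realType) (n : nat) (x : 'cV[R]_n) : 0 <= sqnorm x.
Proof. by apply: sumr_ge0 => i _; exact: sqr_ge0. Qed.

Lemma sqnorm_eq0 (R : realType) (n : nat) (x : 'cV[R]_n) :
  sqnorm x = 0 -> x = 0.
Proof.
move=> /eqP; rewrite psumr_eq0 => [/allP x0|i _]; last exact: sqr_ge0.
apply/colP => i; rewrite mxE; apply/eqP; rewrite -sqrf_eq0.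
by have := x0 i (mem_index_enum i).
Qed.

Lemma tr_mulmx_sqnorm (R : realType) (n : nat) (x : 'cV[R]_n) :
  (x^T *m x) 0 0 = sqnorm x.
Proof. by rewrite mxE; apply: eq_bigr => i _; rewrite mxE expr2. Qed.

Lemma sqnormDZ (R : realType) (n : nat) (d k : 'cV[R]_n) (t : R) :
  sqnorm (d + t *: k) =
  sqnorm d + (t * (d^T *m k) 0 0 *+ 2 + t ^+ 2 * sqnorm k).
Proof.
rewrite mxE /sqnorm !mulr_sumr -sumrMnl -!big_split /=.
by apply: eq_bigr => i _; rewrite !mxE; ring.
Qed.

Lemma continuous_sqnorm (R : realType) (n : nat) :
  continuous (@sqnorm R n).
Proof.
apply: continuous_big => [|i _ x]; first exact: add_continuous.
apply: (@continuous_comp _ _ _ (fun z : 'cV[R]_n => z i 0) (fun t => t ^+ 2)).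
  exact: coord_continuous.
exact: exprn_continuous.
Qed.

Lemma trmx_continuous (R : realType) (m n : nat) :
  continuous (@trmx R m n).
Proof.
move=> A s /= /nbhs_ballP[e /= e0 es]; apply/nbhs_ballP; exists e => //= B.
by move=> [_ AB]; apply: es; split=> // i j; rewrite !mxE.
Qed.

(** The sublevel set of the squared distance through any point of [C] is closed
    and bounded, hence compact, and a continuous function attains its minimum
    there.  The argument is transported to row vectors, for which the
    compactness criterion and the extreme value theorem are stated. *)
Lemma closest_point (R : realType) (n : nat) (C : set 'cV[R]_n) (v : 'cV[R]_n) :
  closed C -> C !=set0 ->
  exists2 p, C p & forall q, C q -> sqnorm (p - v) <= sqnorm (q - v).
Proof.
move=> Cclosed [c Cc].
pose f (u : 'rV[R]_n) := sqnorm (u^T - v).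
have f_cont : continuous f.
  move=> u; apply: continuous_comp; last exact: continuous_sqnorm.
  by apply: continuousB; [exact: trmx_continuous|exact: cst_continuous].
pose S := (@trmx R 1 n @^-1` C) `&` (f @^-1` [set t | t <= sqnorm (c - v)]).
have S_closed : closed S.
  apply: closedI; apply: preimage_closed => //.
  by move=> u _; exact: trmx_continuous.
have S_bounded : bounded_set S.
  pose M := `|v^T| + (1 + sqnorm (c - v)).
  exists M; split=> [|x Mx u [_ /= uS]]; first exact: num_real.
  apply: (le_trans _ (ltW Mx)); rewrite -[u](subrK v^T) addrC.
  apply: (le_trans (ler_normD _ _)); rewrite lerD2l.
  have sq0 := sqnorm_ge0 (c - v).
  rewrite [leLHS]/Num.norm /= mx_normrE; apply/bigmax_leP; split; first lra.
  move=> [i j] _ /=; rewrite (ord1 i) {i}.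
  (* From [a ^+ 2 <= s] follows [`|a| <= 1 + s], which avoids square roots. *)
  have : (u 0 j - v j 0) ^+ 2 <= sqnorm (c - v).
    apply: le_trans uS; rewrite /f /sqnorm (bigD1 j)//= !mxE lerDl.
    by apply: sumr_ge0 => i _; exact: sqr_ge0.
  rewrite !mxE ler_norml => h; apply/andP; split; nra.
have S_neq0 : S !=set0 by exists c^T; split; rewrite /f /= trmxK.
have [p pS pmin] := EVT_min_rV S_neq0 (bounded_closed_compact S_bounded S_closed)
  (continuous_subspaceT f_cont).
move: pS; rewrite inE => -[Cp pc]; exists p^T => // q Cq.
(* Points of [C] outside the sublevel set are farther from [v] than [c] is. *)
have [qc|/ltW cq] := leP (sqnorm (q - v)) (sqnorm (c - v)).
  by have := pmin q^T; rewrite inE /f trmxK; apply; split; rewrite /f /= trmxK.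
exact: le_trans cq.
Qed.

(** First-order optimality: divided by [t], the inequality tends to [0 <= 2 b]
    as [t] tends to [0]. *)
Lemma ge0_of_quadratic (R : realFieldType) (b c : R) : 0 <= c ->
  (forall t, 0 < t <= 1 -> 0 <= t * b *+ 2 + t ^+ 2 * c) -> 0 <= b.
Proof.
move=> c0 bc; rewrite leNgt; apply/negP => b0.
(* If [b < 0], the value of [2 b + t c] at [t = - b / (c - b)] is at most
   [b]; this [t] lies in the allowed range for every [c >= 0]. *)
have cb : 0 < c - b by lra.
have t0 : 0 < - b / (c - b) by rewrite divr_gt0// oppr_gt0.
have t1 : - b / (c - b) <= 1 by rewrite ler_pdivrMr//; lra.
have := bc (- b / (c - b)); rewrite t0 t1 => /(_ isT).
set t := - b / (c - b).
have -> : t * b *+ 2 + t ^+ 2 * c = t * (b + (b + t * c)) by ring.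
rewrite pmulr_rge0//.
have : t * c <= - b; last by lra.
by rewrite /t mulrAC ler_pdivrMr//; nra.
Qed.

Lemma convex_coneD (R : realType) (n : nat) (K : set 'cV[R]_n) (x y : 'cV[R]_n) :
  convex_cone K -> K x -> K y -> K (x + y).
Proof. by move=> K_cone Kx Ky; apply: K_cone.1; exists x => //; exists y. Qed.

Lemma convex_coneZ (R : realType) (n : nat) (K : set 'cV[R]_n) (a : R)
    (x : 'cV[R]_n) : convex_cone K -> 0 <= a -> K x -> K (a *: x).
Proof. by move=> K_cone a0 Kx; apply: (K_cone.2 a a0); exists x. Qed.

(** Let [p] be the point of [K] closest to [v], and [d = p - v].  Moving from [p]
    by [t k] with [k] in [K] stays in [K] and cannot decrease the distance to
    [v], so [d] is nonnegative on [K].  Shrinking [p] to [(1 - t) p] also stays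
    in [K], so [d] is nonpositive at [p]; hence its value at [v = p - d] is at
    most [- |d|^2 < 0]. *)
Lemma convex_cone_separation (R : realType) (n : nat) (K : set 'cV[R]_n)
    (v : 'cV[R]_n) :
  convex_cone K -> closed K -> K !=set0 -> ~ K v ->
  exists2 y : 'rV[R]_n, (y *m v) 0 0 < 0 & forall x, K x -> 0 <= (y *m x) 0 0.
Proof.
move=> K_cone K_closed K_neq0 Kv.
have [p Kp pmin] := closest_point v K_closed K_neq0.
set d := p - v.
have grow k t : K (p + t *: k) ->
    0 <= t * (d^T *m k) 0 0 *+ 2 + t ^+ 2 * sqnorm k.
  by move=> /pmin; rewrite addrAC -/d sqnormDZ lerDl.
exists d^T; last first.
  move=> k Kk; apply: (@ge0_of_quadratic _ _ (sqnorm k)) => [|t /andP[t0 _]].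
    exact: sqnorm_ge0.
  by apply: grow; apply: convex_coneD => //; apply: convex_coneZ => //; exact: ltW.
have dp : (d^T *m p) 0 0 <= 0.
  rewrite -oppr_ge0; apply: (@ge0_of_quadratic _ _ (sqnorm p)) => [|t /andP[t0 t1]].
    exact: sqnorm_ge0.
  have := grow p (- t); rewrite mulrN mulNr sqrrN; apply.
  by rewrite -{1}[p]scale1r -scalerDl; apply: convex_coneZ => //; lra.
have d_gt0 : 0 < sqnorm d.
  rewrite lt_neqAle sqnorm_ge0 andbT eq_sym; apply/eqP => /sqnorm_eq0 /eqP.
  by rewrite subr_eq0 => /eqP pv; apply: Kv; rewrite -pv.
have -> : v = p - d by rewrite opprB addrC subrK.
rewrite mulmxBr [ltLHS]mxE [X in _ + X]mxE tr_mulmx_sqnorm; lra.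
Qed.

(** The affine homeomorphism [z |-> k + s z] maps [K] into itself, hence a
    neighbourhood of [b] inside [K] onto a neighbourhood of [k + s b] inside
    [K]. *)
Lemma interior_convex_coneDZ (R : realType) (n : nat) (K : set 'cV[R]_n)
    (k b : 'cV[R]_n) (s : R) :
  convex_cone K -> K k -> interior K b -> 0 < s -> interior K (k + s *: b).
Proof.
move=> K_cone Kk Kb s0.
have g_cont : continuous (fun z : 'cV[R]_n => s^-1 *: (z - k)).
  have sub_cont : continuous (fun z : 'cV[R]_n => z - k).
    by move=> z; apply: continuousB; [exact: cvg_id|exact: cst_continuous].
  have scale_cont : continuous (fun z : 'cV[R]_n => s^-1 *: z).
    exact: scaler_continuous.
  by move=> z; exact: (continuous_comp (sub_cont z) (scale_cont _)).
have := g_cont (k + s *: b) K.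
rewrite /= [k + _]addrC addrK scalerA mulVf ?gt_eqF// scale1r.
move=> /(_ Kb) /nbhs_ballP[e e0 eK].
apply/nbhs_ballP; exists e => // z /eK /= Kz.
rewrite -(subrK k z) addrC; apply: convex_coneD => //.
rewrite -(scale1r (z - k)) -(divff (lt0r_neq0 s0)) -scalerA.
by apply: convex_coneZ => //; exact: ltW.
Qed.

(** From an interior point [b] a small step in the direction [v] stays in [K] and
    strictly decreases [y], which is still nonnegative after the step. *)
Lemma interior_functional_gt0 (R : realType) (n : nat) (K : set 'cV[R]_n)
    (y : 'rV[R]_n) (v b : 'cV[R]_n) :
  (forall x, K x -> 0 <= (y *m x) 0 0) -> (y *m v) 0 0 < 0 ->
  interior K b -> 0 < (y *m b) 0 0.
Proof.
move=> y_ge0 yv Kb.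
have l_cont : continuous (fun t : R => b + t *: v).
  have scale_cont : continuous (fun t : R => t *: v) by exact: scalel_continuous.
  have add_cont : continuous (fun z : 'cV[R]_n => b + z).
    by move=> z; apply: continuousD; [exact: cst_continuous|exact: cvg_id].
  by move=> t; exact: (continuous_comp (scale_cont t) (add_cont _)).
have := l_cont 0 K; rewrite /= scale0r addr0 => /(_ Kb) /nbhs_ballP[e /= e0 eK].
have e2 : 0 < e / 2 by rewrite divr_gt0.
have /eK/y_ge0 : ball (0 : R) e (e / 2).
  by rewrite /ball /= sub0r normrN gtr0_norm// gtr_pMr// invf_lt1// ltr1n.
rewrite mulmxDr -scalemxAr [leRHS]mxE [X in _ + X]mxE => h.
have : e / 2 * (y *m v) 0 0 < 0 by rewrite pmulr_rlt0.
lra.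
Qed.

(** Every point of the cone is a limit of the interior points [x + s a], with [a]
    interior and [s] decreasing to [0]. *)
Lemma interior_cone_functional_lt0 (R : realType) (n : nat) (K : set 'cV[R]_n)
    (z : 'rV[R]_n) (x : 'cV[R]_n) :
  convex_cone K -> interior K !=set0 -> K x -> (z *m x) 0 0 < 0 ->
  exists2 x0, interior K x0 & (z *m x0) 0 0 < 0.
Proof.
move=> K_cone [a Ka] Kx zx.
set c := (z *m x) 0 0 in zx; set d := (z *m a) 0 0.
have d1 : 0 < `|d| + 1 by rewrite ltr_wpDl.
(* Any [s > 0] with [s * d < - c] works, whatever the sign of [d]. *)
pose s := - c / (`|d| + 1).
have s0 : 0 < s by rewrite divr_gt0// oppr_gt0.
exists (x + s *: a); first exact: interior_convex_coneDZ.
have -> : (z *m (x + s *: a)) 0 0 = c + s * d.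
  by rewrite mulmxDr -scalemxAr mxE [in X in _ + X]mxE.
have sd : s * d <= s * `|d| by rewrite ler_pM2l// ler_norm.
have : s * (`|d| + 1) = - c by rewrite /s divfK// gt_eqF.
lra.
Qed.

Theorem theorem2p3 (R : realType) (m n : nat) (A : 'M[R]_(m, n))
    (K1 : set 'cV[R]_n) (K2 : set 'cV[R]_m)
    (hK1 : proper_cone K1) (hK2 : proper_cone K2)
    (hA : forall B : 'M[R]_(m, n),
        semipos_mx K1 K2 B -> semipos_mx K1 K2 (A + B)) :
  nonneg_mx K1 K2 A.
Proof.
move: hK1 hK2 => [K1_cone _ _ K1_int] [K2_cone K2_closed _ [b K2b]].
move=> _ [x K1x <-]; apply: contrapT => K2Ax.
have K2_neq0 : K2 !=set0 by exists b; exact: interior_subset K2b.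
have [y yAx y_ge0] := convex_cone_separation K2_cone K2_closed K2_neq0 K2Ax.
have y_gt0 w : interior K2 w -> 0 < (y *m w) 0 0.
  exact: interior_functional_gt0 y_ge0 yAx.
have yb := y_gt0 b K2b.
have [x0 K1x0 yAx0] : exists2 x0, interior K1 x0 & (y *m A *m x0) 0 0 < 0.
  by apply: interior_cone_functional_lt0 K1x _ => //; rewrite -mulmxA.
pose B := - ((y *m b) 0 0)^-1 *: (b *m (y *m A)).
have semipos_B : semipos_mx K1 K2 B.
  exists x0 => //.
  (* The summand [0] is the point of the cone in [interior_convex_coneDZ]. *)
  have -> : B *m x0 = 0 + (- ((y *m b) 0 0)^-1 * (y *m A *m x0) 0 0) *: b.
    rewrite -scalemxAl -(mulmxA b) {1}[y *m A *m x0]mx11_scalar mul_mx_scalar.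
    by rewrite scalerA add0r.
  apply: interior_convex_coneDZ => //.
    by rewrite -(scale0r b); apply: convex_coneZ => //; exact: interior_subset K2b.
  by rewrite mulNr -mulrN mulr_gt0 ?invr_gt0 ?oppr_gt0.
have yAB : y *m (A + B) = 0.
  rewrite mulmxDr -scalemxAr (mulmxA y b) {2}[y *m b]mx11_scalar mul_scalar_mx.
  by rewrite scalerA mulNr mulVf ?gt_eqF// scaleN1r subrr.
have [w _ /y_gt0] := hA B semipos_B.
by rewrite mulmxA yAB mul0mx mxE ltxx.
Qed.
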